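(* Let $P$ be a finite poset. Then the lattice $LC(P)$ is supersolvable, i.e. it contains a maximal chain all of whose elements are modular elements of $LC(P)$.
   Context: A closure relation on a poset $P$ is a map $H:P\to P$ such that for all $x,y\in P$: (1) $x\le H(x)$; (2) $x\le y$ implies $H(x)\le H(y)$; (3) $H(H(x))=H(x)$. $LC(P)$ is the lattice of all closure relations on $P$, ordered by $H\le K$ if and only if $H(x)\le K(x)$ for all $x\in P$. An element $H$ of a lattice $L$ is modular if and only if for all $K\le K'$ in $L$, the equalities $H\vee K=H\vee K'$ and $H\wedge K=H\wedge K'$ together imply $K=K'$. *)

(* Defs.v *)
From HB Require Import structures.
From mathcomp Require Import all_boot all_order.
Set Implicit Arguments.
Unset Strict Implicit.
Unset Printing Implicit Defensive.
Import Order.TTheory.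
Local Open Scope order_scope.

Definition is_closure d (P : finPOrderType d) (H : {ffun P -> P}) : bool :=
  [&& [forall x, x <= H x],
      [forall x, forall y, (x <= y) ==> (H x <= H y)]
    & [forall x, H (H x) == H x]].

Record LC d (P : finPOrderType d) := ClosureRelation {
  closure_fun :> {ffun P -> P};
  closure_funP : is_closure closure_fun
}.

HB.instance Definition _ d (P : finPOrderType d) :=
  [isSub for @closure_fun d P].
HB.instance Definition _ d (P : finPOrderType d) := [Finite of LC P by <:].

Lemma is_closureP d (P : finPOrderType d) (H : {ffun P -> P}) :
  reflect [/\ forall x, x <= H x,
              forall x y, x <= y -> H x <= H y
            & forall x, H (H x) = H x]
          (is_closure H).
Proof.
apply: (iffP and3P) => -[h1 h2 h3]; split.
- exact/forallP.
- by move=> x y; move/forallP/(_ x)/forallP/(_ y)/implyP: h2.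
- by move=> x; apply/eqP; move/forallP: h3.
- exact/forallP.
- by apply/forallP=> x; apply/forallP=> y; apply/implyP/h2.
- by apply/forallP=> x; apply/eqP.
Qed.

Fact closure_display : Order.disp_t. Proof. exact: Order.Disp tt tt. Qed.

Section ClosureLattice.
Variables (d : Order.disp_t) (P : finPOrderType d).
Implicit Types (H K M : LC P) (x y : P).

Lemma closure_ge H x : x <= H x.
Proof. by have /is_closureP[] := closure_funP H. Qed.

Lemma closure_homo H x y : x <= y -> H x <= H y.
Proof. by have /is_closureP[_ h _] := closure_funP H; apply: h. Qed.

Lemma closure_idem H x : H (H x) = H x.
Proof. by have /is_closureP[] := closure_funP H. Qed.

Definition le_closure H K : bool := [forall x, H x <= K x].

Fact le_closure_refl : reflexive le_closure.
Proof. by move=> H; apply/forallP. Qed.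

Fact le_closure_anti : antisymmetric le_closure.
Proof.
move=> H K /andP[/forallP HK /forallP KH]; apply/val_inj/ffunP => x.
by apply/le_anti; rewrite HK KH.
Qed.

Fact le_closure_trans : transitive le_closure.
Proof.
move=> K H M /forallP HK /forallP KM; apply/forallP => x.
exact: le_trans (HK x) (KM x).
Qed.

HB.instance Definition _ := Order.Le_isPOrder.Build closure_display (LC P)
  le_closure_refl le_closure_anti le_closure_trans.

Lemma leCP H K : reflect (forall x, H x <= K x) (H <= K).
Proof. exact: forallP. Qed.

(* The join of H and K is the limit of the iterates of their composite, which
   is reached after at most #|P| steps. *)
Definition join_closure_fun H K : {ffun P -> P} :=
  [ffun x => iter #|P| (fun y => H (K y)) x].

Fact join_closure_fix H K x :
  H (K (join_closure_fun H K x)) = join_closure_fun H K x.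
Proof.
rewrite ffunE; set g := fun y => H (K y).
have gge y : y <= g y by apply: le_trans (closure_ge K y) (closure_ge H _).
have ile m n : (m <= n)%N -> iter m g x <= iter n g x.
  move/subnK <-; elim: (n - m)%N => [|k IH] //.
  by rewrite addSn iterS; apply: le_trans IH (gge _).
have lp : looping g x (fingraph.order g x) by exact: looping_order.
have /trajectP[i lti ei] := lp.
have fi : g (iter i g x) = iter i g x.
  apply/le_anti; rewrite gge andbT -iterS -[X in _ <= X]ei; exact: ile.
have le_i : (i <= #|P|)%N by apply: leq_trans (ltnW lti) (max_card _).
rewrite -(subnK le_i) iterD iter_fix //.
Qed.

Fact join_closure_subproof H K : is_closure (join_closure_fun H K).
Proof.
apply/is_closureP; split=> [x|x y xy|x].
- rewrite ffunE; elim: #|P| => //= n /le_trans; apply.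
  exact: le_trans (closure_ge K _) (closure_ge H _).
- rewrite !ffunE; elim: #|P| => //= n IH.
  exact/closure_homo/closure_homo.
- by rewrite [LHS]ffunE iter_fix // join_closure_fix.
Qed.

Definition join_closure H K : LC P :=
  ClosureRelation (join_closure_subproof H K).

Fact join_closureP H K M :
  (join_closure H K <= M) = (H <= M) && (K <= M).
Proof.
apply/idP/andP => [/leCP le_M|[/leCP HM /leCP KM]].
  have jg x : x <= join_closure H K x by apply: closure_ge.
  have jf x : H (K (join_closure H K x)) = join_closure H K x.
    exact: join_closure_fix.
  split; apply/leCP => x; apply: le_trans (le_M x); rewrite -jf.
    by apply/closure_homo/(le_trans (jg x))/closure_ge.
  by apply: le_trans (closure_ge H _); apply/closure_homo/jg.
apply/leCP => x; rewrite /= ffunE.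
have: iter #|P| (fun y => H (K y)) x <= M x; last by [].
elim: #|P| => [|n IH] /=; first exact: closure_ge.
rewrite -(closure_idem M) -(closure_idem M (M x)).
apply: le_trans (HM _) _; apply/closure_homo.
by apply: le_trans (KM _) _; apply/closure_homo.
Qed.

Fact id_closure_subproof : is_closure [ffun x : P => x].
Proof. by apply/is_closureP; split=> [x|x y|x]; rewrite !ffunE. Qed.

Definition id_closure : LC P := ClosureRelation id_closure_subproof.

Definition meet_closure H K : LC P :=
  \big[join_closure/id_closure]_(M : LC P | (M <= H) && (M <= K)) M.

Fact meet_closureP M H K :
  (M <= meet_closure H K) = (M <= H) && (M <= K).
Proof.
apply/idP/idP => [/le_trans le_M|MHK].
  apply/andP; split; apply: le_M; apply: (big_ind (fun N => N <= _)).
  - by apply/leCP => x; rewrite ffunE closure_ge.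
  - by move=> N N' NH NH'; rewrite join_closureP NH.
  - by move=> N /andP[].
  - by apply/leCP => x; rewrite ffunE closure_ge.
  - by move=> N N' NK NK'; rewrite join_closureP NK.
  - by move=> N /andP[].
have jl N N' : N <= join_closure N N'.
  by have := join_closureP N N' (join_closure N N'); rewrite lexx => /esym/andP[].
have jr N N' : N' <= join_closure N N'.
  by have := join_closureP N N' (join_closure N N'); rewrite lexx => /esym/andP[].
rewrite /meet_closure; have := mem_index_enum M.
elim: (index_enum _) => // N r IH; rewrite in_cons big_cons => /predU1P[<-|/IH].
  by rewrite MHK; apply: jl.
by case: ifP => // _ /le_trans; apply; apply: jr.
Qed.

HB.instance Definition _ := Order.POrder_MeetJoin_isLattice.Build
  closure_display (LC P) meet_closureP join_closureP.

End ClosureLattice.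

Definition modular d (L : latticeType d) (h : L) : Prop :=
  forall k k' : L, k <= k' ->
    h `|` k = h `|` k' -> h `&` k = h `&` k' -> k = k'.

Definition chain d (L : finPOrderType d) (C : {set L}) : bool :=
  [forall x in C, forall y in C, x >=< y].

Definition supersolvable d (L : finLatticeType d) : Prop :=
  exists2 C : {set L}, maxset (@chain d L) C
                     & forall h : L, h \in C -> modular h.

(* Main.v *)
Require Import Defs.
From mathcomp Require Import all_boot all_order.

Set Implicit Arguments.
Unset Strict Implicit.
Unset Printing Implicit Defensive.
Import Order.TTheory.
Local Open Scope order_scope.

(** A closure [K] may be restricted to an up-set [U] of [P]: let it act as [K]
    on [U] and as the identity elsewhere ([restrict]). Let [T] be the greatest
    closure. The restrictions of [T] to up-sets are modular
    ([restrict_top_modular]): for [H := restrict U T] and any [K], the meet of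
    [H] and [K] lies above [restrict U K], hence determines [K] on [U], while
    the join determines which points outside [U] are closed under [K], because
    the closed points of a join are the common closed points. These two pieces
    of data determine [K].

    A maximal chain of such restrictions comes from a linear extension of [P],
    given by an injective strictly decreasing [r : P -> nat]: the points with
    [r x < n] form an up-set, which gains at most one point [x] when [n] grows
    by one. A closure [K] between two consecutive restrictions can differ from
    them only at [x]. If [x < K x], then [K x] lies in the smaller up-set, where
    [K] agrees with [T]; so [K x] is closed under [T] and [K x = T x]. Thus
    nothing lies strictly between consecutive restrictions
    ([restrict_top_cover]), and the chain is maximal. *)

Section Closures.
Variables (d : Order.disp_t) (P : finPOrderType d).
Implicit Types (H K M T : LC P) (x y : P) (U V : pred P).

Definition upset U : Prop := forall x y, x <= y -> U x -> U y.

(** Closures move points up, so the up-set [U] is stable under [K], which gives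
    idempotence; monotonicity holds across the boundary of [U] because the side
    acted upon by [K] is the upper one. *)
Lemma restrict_subproof U (upU : upset U) K :
  is_closure [ffun x => if U x then K x else x].
Proof.
apply/is_closureP; split=> [x|x y le_xy|x]; rewrite !ffunE.
- by case: ifP => // _; apply: closure_ge.
- case: ifP => [Ux|_]; first by rewrite (upU _ _ le_xy Ux) closure_homo.
  by case: ifP => // _; apply: le_trans le_xy (closure_ge K y).
- case Ux: (U x); last by rewrite Ux.
  by rewrite (upU _ _ (closure_ge K x) Ux) closure_idem.
Qed.

Definition restrict U (upU : upset U) K : LC P :=
  ClosureRelation (restrict_subproof upU K).

Lemma restrictE U (upU : upset U) K x :
  restrict upU K x = if U x then K x else x.
Proof. by rewrite ffunE. Qed.

(** A closure sends [x] to the least closed point above [x]; with more closed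
    points to choose from, that least one can only go down. *)
Lemma closed_sub_le K K' : (forall y, K y = y -> K' y = y) -> K' <= K.
Proof.
move=> sub; apply/leCP => x; rewrite -(sub (K x) (closure_idem K x)).
exact/closure_homo/closure_ge.
Qed.

Lemma join_closed H K x : H x = x -> K x = x -> (H `|` K) x = x.
Proof.
by move=> Hx Kx; rewrite /= ffunE iter_fix // Kx.
Qed.

Lemma le_closed H K x : H <= K -> K x = x -> H x = x.
Proof.
move=> /leCP/(_ x) leHK Kx; apply/le_anti.
by rewrite closure_ge andbT -[X in _ <= X]Kx.
Qed.

(** The meet has no pointwise formula, but [restrict U K'] is a lower bound of
    [K'] and of [H := restrict U T] with the values of [K'] on [U]; this is
    enough to recover [K'] there. Outside [U] every point is closed under [H],
    so there the closed points of [K] are those of the join. *)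
Lemma restrict_top_modular U (upU : upset U) T :
  (forall K, K <= T) -> modular (restrict upU T).
Proof.
move=> topT K K' leKK' eqJ eqM; apply/le_anti; rewrite leKK' /=.
set H := restrict upU T in eqJ eqM.
have le_onU x : U x -> K' x <= K x.
  move=> Ux.
  have leH : restrict upU K' <= H.
    apply/leCP => y; rewrite !restrictE; case: ifP => // _.
    by move: y; apply/leCP/topT.
  have leK' : restrict upU K' <= K'.
    apply/leCP => y; rewrite restrictE; case: ifP => // _; exact: closure_ge.
  have : restrict upU K' <= K.
    by have := leIr K H; apply: le_trans; rewrite eqM lexI leH.
  by move/leCP/(_ x); rewrite restrictE Ux.
apply: closed_sub_le => y Ky.
have [Uy|nUy] := boolP (U y).
  by apply/le_anti; rewrite closure_ge andbT -[X in _ <= X]Ky le_onU.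
have Hy : H y = y by rewrite restrictE (negbTE nUy).
have := join_closed Hy Ky; rewrite eqJ.
exact/le_closed/leUr.
Qed.

(** If [K] moves [x], it moves it into [U], where the only available closed
    points are those of [T]: the image of [x] is [x] itself or [T x]. *)
Lemma restrict_top_cover U V (upU : upset U) (upV : upset V) T K x :
    (forall M, M <= T) -> (forall y, V y -> y != x -> U y) ->
    (forall y, x < y -> U y) ->
    restrict upU T <= K -> K <= restrict upV T ->
  K = restrict upU T \/ restrict upV T <= K.
Proof.
move=> topT VU gtU leUK leKV.
have KU y : U y -> K y = T y.
  move=> Uy; apply/le_anti; have/leCP-> /= := topT K.
  by move/leCP/(_ y): leUK; rewrite restrictE Uy.
have Kfix y : y != x -> ~~ U y -> K y = y.
  move=> ny nUy; apply: (le_closed leKV); rewrite restrictE.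
  by case: ifP => // Vy; rewrite (VU y) in nUy.
have [Kx|Kx] := eqVneq (K x) x.
  left; apply/le_anti; rewrite leUK andbT; apply/leCP => y.
  rewrite restrictE; case: ifP => [/KU->//|/negbT nUy].
  by have [->|ny] := eqVneq y x; rewrite ?Kx // Kfix.
right; apply/leCP => y; rewrite restrictE.
case: ifP => [Vy|_]; last exact: closure_ge.
have [->|ny] := eqVneq y x; last by rewrite KU // VU.
have ltx : x < K x by rewrite lt_def Kx closure_ge.
by rewrite -(closure_idem K) (KU _ (gtU _ ltx)) closure_homo // ltW.
Qed.

Lemma exists_top_closure : exists T, forall K, K <= T.
Proof.
suff [T leT] : exists T, {in enum {: LC P}, forall K, K <= T}.
  by exists T => K; rewrite leT ?mem_enum.
elim: (enum _) => [|M s [T leT]]; first by exists (id_closure P).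
exists (M `|` T) => K; rewrite inE => /predU1P[->|/leT leK]; first exact: leUl.
exact: le_trans leK (leUr _ _).
Qed.

(** The principal filter of [x] shrinks when [x] grows; adding the position of
    [x] in an enumeration as a low-order digit separates the remaining ties. *)
Lemma exists_linear_extension :
  exists2 r : P -> nat, injective r & forall x y, x < y -> (r y < r x)%N.
Proof.
pose h x := #|[set y | x <= y]|.
have lt_h x y : x < y -> (h y < h x)%N.
  move=> ltxy; apply/proper_card/properP; split.
    by apply/subsetP => z; rewrite !inE; apply/le_trans/ltW.
  by exists x; rewrite !inE ?lexx // lt_geF.
exists (fun x => h x * #|P| + enum_rank x)%N => [x y eq_r|x y /lt_h lt].
  apply/enum_rank_inj/val_inj.
  by have /(congr1 (modn^~ #|P|)) := eq_r; rewrite !modnMDl !modn_small.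
apply: leq_trans (leq_addr _ _).
apply: (@leq_trans ((h y).+1 * #|P|)); last by rewrite leq_mul2r lt orbT.
by rewrite mulSn addnC ltn_add2r.
Qed.

End Closures.

Theorem theorem10 (d : Order.disp_t) (P : finPOrderType d) :
  supersolvable (LC P).
Proof.
have [T topT] := exists_top_closure P.
have [r r_inj r_anti] := exists_linear_extension P.
have up n : upset (fun x : P => (r x < n)%N).
  move=> x y; rewrite le_eqVlt => /predU1P[->//|/r_anti].
  exact: ltn_trans.
pose B := \max_x r x; pose h n := restrict (up n) T.
have rB x : (r x < B.+1)%N by rewrite ltnS; apply: leq_bigmax.
have h0 K : h 0 <= K.
  by apply/leCP => x; rewrite restrictE ltn0 closure_ge.
have hB : h B.+1 = T.
  by apply/val_inj/ffunP => x; rewrite restrictE rB.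
have h_homo m n : (m <= n)%N -> h m <= h n.
  move=> lemn; apply/leCP => x; rewrite !restrictE.
  case: ifP => [ltm|_]; first by rewrite (leq_trans ltm lemn).
  by case: ifP => // _; apply: closure_ge.
pose C := [set h n | n : 'I_B.+2].
have hC n : (n < B.+2)%N -> h n \in C.
  by move=> lt; apply/imsetP; exists (Ordinal lt).
exists C => [|_ /imsetP[n _ ->]]; last exact: restrict_top_modular.
apply/maxsetP; split.
  apply/forall_inP => _ /imsetP[m _ ->]; apply/forall_inP => _ /imsetP[n _ ->].
  by case/orP: (leq_total m n) => /h_homo le;
    [apply: le_comparable|apply: ge_comparable].
move=> D chD subCD; apply/eqP; rewrite eqEsubset subCD andbT.
apply/subsetP => K KD.
have cmp n : (n < B.+2)%N -> h n >=< K.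
  move=> /hC/(subsetP subCD) hD.
  by move/forall_inP/(_ _ hD)/forall_inP: chD; apply.
have [TK|nTK] := boolP (h B.+1 <= K).
  suff -> : K = h B.+1 by apply: hC.
  by apply/le_anti; rewrite TK hB topT.
(* [n.+1] is the first index at which the chain stops being below [K]. *)
have ex : exists n, ~~ (h n <= K) by exists B.+1.
case: (ex_minnP ex) => [[|n]]; first by rewrite h0.
move=> nle min; have lt_nB : (n < B.+1)%N by apply: min.
have le_n : h n <= K.
  by apply/negPn/negP => /min; rewrite ltnn.
have le_Sn : K <= h n.+1.
  by have := cmp n.+1 lt_nB; rewrite /Order.comparable (negbTE nle).
suff -> : K = h n by apply/hC/ltnW.
have [x /eqP rx|no] := pickP (fun x => r x == n); last first.
  (* No point has value [n], so the chain repeats itself there. *)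
  case/negP: nle; apply: le_trans le_n; apply/leCP => y.
  by rewrite !restrictE ltnS leq_eqVlt no.
have [||->|le] := @restrict_top_cover _ _ _ _ (up n) (up n.+1) T K x
  topT _ _ le_n le_Sn.
- move=> y /=; rewrite ltnS leq_eqVlt => /predU1P[ry|//].
  by rewrite (r_inj y x) ?eqxx // ry rx.
- by move=> y /r_anti; rewrite rx.
- by [].
- by rewrite le in nle.
Qed.
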